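(* Let $n\ge 1$ be an integer and let $f:\mathbb{R}^n\to\mathbb{R}$ be a Borel function with $f(x)>0$ for every $x\in\mathbb{R}^n$ and $\int_{\mathbb{R}^n} f(x)\,dx=1$ (a positive density function). Then the following are equivalent. (i) For every $y\in\mathbb{R}^n$, the function $x\mapsto f(x+y)/f(x)$ is convex on $\mathbb{R}^n$. (ii) For every $y\in\mathbb{R}^n$, the function $x\mapsto f(x+y)/f(x)$ is log-convex on $\mathbb{R}^n$. (iii) For every $y\in\mathbb{R}^n$, the function $x\mapsto f(x+y)/f(x)$ is log-concave on $\mathbb{R}^n$. (iv) $f$ is a multivariate normal density (necessarily with positive definite covariance matrix), i.e. there exist $\mu\in\mathbb{R}^n$ and a symmetric positive definite matrix $\Sigma\in\mathbb{R}^{n\times n}$ such that for every $x\in\mathbb{R}^n$, $$f(x)=\frac{1}{(2\pi)^{n/2}(\det\Sigma)^{1/2}}\exp\left(-\frac12 (x-\mu)^T\Sigma^{-1}(x-\mu)\right).$$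
   Context: A strictly positive function $h:\mathbb{R}^n\to(0,\infty)$ is called log-convex if $\log h$ is convex, and log-concave if $\log h$ is concave. Integration is with respect to Lebesgue measure on $\mathbb{R}^n$. *)

(* Defs.v *)
From HB Require Import structures.
From mathcomp Require Import all_boot all_order all_algebra.
From mathcomp Require Import all_classical all_reals all_analysis.
From mathcomp Require Import measurable_realfun.

Set Implicit Arguments.
Unset Strict Implicit.
Unset Printing Implicit Defensive.

Import Order.TTheory GRing.Theory Num.Theory.
Import numFieldNormedType.Exports.

Local Open Scope classical_set_scope.
Local Open Scope ring_scope.

(* Borel sigma-algebra for the product topology of MathComp-Analysis on
   matrices; R^n is 'cV[R]_n. *)
Section matrix_borel.
Context {R : realType} {m n : nat}.

Let mxborel : set (set 'M[R]_(m, n)) := <<s open >>.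

Let mxborel0 : mxborel set0.
Proof. exact: sigma_algebra0. Qed.

Let mxborelC A : mxborel A -> mxborel (~` A).
Proof. exact: sigma_algebraC. Qed.

Let mxborel_bigcup (F : (set 'M[R]_(m, n))^nat) :
  (forall i, mxborel (F i)) -> mxborel (\bigcup_i F i).
Proof. exact: sigma_algebra_bigcup. Qed.

HB.instance Definition _ := @isMeasurable.Build default_measure_display
  'M[R]_(m, n) mxborel mxborel0 mxborelC mxborel_bigcup.

Lemma measurable_mxE : @measurable _ 'M[R]_(m, n) = <<s open >>.
Proof. by []. Qed.

Lemma measurable_mx_coord i j :
  measurable_fun [set: 'M[R]_(m, n)] (fun x : 'M[R]_(m, n) => x i j).
Proof.
apply: (measurability _ (RGenOpens.measurableE R)).
move=> _ [_ [a [b ->] <-]]; rewrite setTI; apply: sub_sigma_algebra.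
have /continuousP := @coord_continuous R m n i j; apply.
exact: interval_open.
Qed.

Lemma measurable_fun_mx d (T : measurableType d) (f : T -> 'M[R]_(m, n)) :
  (forall i j, measurable_fun setT (fun t => f t i j)) ->
  measurable_fun setT f.
Proof.
move=> mf; apply: (measurability _ measurable_mxE) => _ [U oU <-].
rewrite setTI.
pose B (p : 'M[rat]_(m, n) * nat) : set 'M[R]_(m, n) :=
  [set y | forall i j, ball (ratr (p.1 i j) : R) p.2.+1%:R^-1 (y i j)].
have mB p : measurable (f @^-1` B p).
  have -> : f @^-1` B p = \bigcap_(ij in [set: 'I_m * 'I_n])
      ((fun t => f t ij.1 ij.2) @^-1` ball (ratr (p.1 ij.1 ij.2) : R)
         p.2.+1%:R^-1).
    rewrite predeqE => t; split=> [Bt [i j] _|Bt i j]; first exact: Bt.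
    exact: (Bt (i, j)).
  apply: fin_bigcap_measurable => // -[i j] _.
  rewrite -[X in measurable X]setTI; apply: mf => //.
  exact: measurable_ball.
have -> : f @^-1` U = \bigcup_p
    (if `[< B p `<=` U >] then f @^-1` B p else set0).
  rewrite predeqE => t; split=> [Ut|[p _]]; last first.
    by case: ifPn => // /asboolP BU /BU.
  have /nbhs_ballP[e /= e0 eU] : nbhs (f t) U by exact: open_nbhs_nbhs.
  have [k ke] : exists k : nat, k.+1%:R^-1 < e / 2.
    have e20 : 0 < e / 2 by rewrite divr_gt0.
    have [k _ /(_ _ (leqnn k))] := near_infty_natSinv_lt (PosNum e20).
    by exists k.
  have k0 : 0 < k.+1%:R^-1 :> R by rewrite invr_gt0.
  have /choice[q qP] : forall ij : 'I_m * 'I_n, exists q : rat,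
      ball (f t ij.1 ij.2) k.+1%:R^-1 (ratr q : R).
    move=> [i j]/=.
    have bn0 : ball (f t i j) k.+1%:R^-1 !=set0.
      by exists (f t i j); exact: ballxx.
    have [z [/= bq [q _ qE]]] := dense_rat bn0 (ball_open _ _).
    by exists q; rewrite qE.
  exists (\matrix_(i, j) q (i, j), k) => //; case: ifPn => [_ i j|].
    by rewrite /= mxE; apply: ball_sym; exact: (qP (i, j)).
  move=> /asboolPn; apply: contra_notP => _ y By; apply: eU.
  split=> // i j; rewrite (splitr e).
  apply: (@ball_triangle _ _ (ratr (q (i, j)) : R)).
    by apply: le_ball (ltW ke) _ (qP (i, j)).
  by have := By i j; rewrite /= mxE; apply: le_ball; exact: ltW.
apply: countable_bigcupT_measurable => [|p]; first exact: countableP.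
by case: ifP.
Qed.

End matrix_borel.

Section lebesgue_measure_cV.
Context {R : realType}.

Definition cons_cV n (p : measurableTypeR R * 'cV[R]_n) : 'cV[R]_n.+1 :=
  col_mx (p.1 : R)%:M p.2.

Lemma cons_cV0 n p : @cons_cV n p ord0 0 = p.1.
Proof.
have -> : ord0 = lshift n 0 :> 'I_(1 + n) by exact/val_inj.
by rewrite [LHS]col_mxEu mxE eqxx mulr1n.
Qed.

Lemma cons_cVS n p i : @cons_cV n p (lift ord0 i) 0 = p.2 i 0.
Proof.
have -> : lift ord0 i = rshift 1 i :> 'I_(1 + n) by exact/val_inj.
by rewrite [LHS]col_mxEd.
Qed.

Lemma measurable_cons_cV n : measurable_fun setT (@cons_cV n).
Proof.
apply: measurable_fun_mx => i j; rewrite ord1.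
case: (unliftP ord0 i) => [k ->|->].
  under eq_fun do rewrite cons_cVS.
  exact: (measurableT_comp (measurable_mx_coord k 0)).
by under eq_fun do rewrite cons_cV0; exact: measurable_fst.
Qed.

Definition uncons_cV n (x : 'cV[R]_n.+1) : measurableTypeR R * 'cV[R]_n :=
  (x ord0 0, \col_i x (lift ord0 i) 0).

Lemma cons_cVK n : cancel (@cons_cV n) (@uncons_cV n).
Proof.
move=> p; rewrite /uncons_cV cons_cV0 [RHS]surjective_pairing; congr pair.
by apply/colP => i; rewrite mxE cons_cVS.
Qed.

Lemma measurable_uncons_cV n : measurable_fun setT (@uncons_cV n).
Proof.
apply: measurable_fun_pair; first exact: measurable_mx_coord.
apply: measurable_fun_mx => i j; under eq_fun do rewrite mxE.
exact: measurable_mx_coord.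
Qed.

Section cons_measure.
Context {n : nat} (mu : {sigma_finite_measure set 'cV[R]_n -> \bar R}).
Local Open Scope ereal_scope.

Definition cons_measure : set 'cV[R]_n.+1 -> \bar R :=
  pushforward (@lebesgue_measure R \x mu) (@cons_cV n).

HB.instance Definition _ := Measure.copy cons_measure
  (measure_function_pushforward__canonical__measure_function_Measure
    (@lebesgue_measure R \x mu) (@measurable_cons_cV n)).

(* The sigma-finiteness instance of product measures is not found by unification
   (the one for products of subprobabilities shadows it), hence the direct
   proof. *)
Let cons_measure_sigma_finite : sigma_finite setT cons_measure.
Proof.
have /sigma_finiteP[F [TF ndF Foo]] := sigma_finiteT (@lebesgue_measure R).
have /sigma_finiteP[G [TG ndG Goo]] := sigma_finiteT mu.
have consK (A : set (measurableTypeR R * 'cV[R]_n)%type) :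
  @cons_cV n @^-1` (@uncons_cV n @^-1` A) = A.
  by rewrite predeqE => p /=; rewrite cons_cVK.
exists (fun k => @uncons_cV n @^-1` (F k `*` G k)) => [|k].
  rewrite predeqE => x; split=> // _.
  have [i _ Fi] : (\bigcup_k F k) (uncons_cV x).1 by rewrite -TF.
  have [j _ Gj] : (\bigcup_k G k) (uncons_cV x).2 by rewrite -TG.
  exists (maxn i j) => //; split.
    by apply: (subsetPset _ _ (ndF _ _ (leq_maxl i j))).
  by apply: (subsetPset _ _ (ndG _ _ (leq_maxr i j))).
have [[mF Fk] [mG Gk]] := (Foo k, Goo k); split.
  rewrite -[X in measurable X]setTI; apply: measurable_uncons_cV => //.
  exact: measurableX.
rewrite /cons_measure /pushforward consK product_measure1E//.
by rewrite lte_mul_pinfty// ge0_fin_numE.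
Qed.

HB.instance Definition _ := Measure_isSigmaFinite.Build _ _ _ cons_measure
  cons_measure_sigma_finite.

End cons_measure.

(* The library has Lebesgue measure on R only. On R^n it is the n-fold product,
   transported along (a, x) |-> col_mx a x; lebesgue_measure_cV_box gives its
   value on boxes, which determines it. *)
Fixpoint lebesgue_measure_cV (n : nat) :
    {sigma_finite_measure set 'cV[R]_n -> \bar R} :=
  match n with
  | 0 => \d_ (0 : 'cV[R]_0)
  | n'.+1 => cons_measure (lebesgue_measure_cV n')
  end.

Lemma lebesgue_measure_cV_box n (A : 'I_n -> set (measurableTypeR R)) :
  (forall i, measurable (A i)) ->
  lebesgue_measure_cV n [set x | forall i, A i (x i 0)] =
  (\prod_(i < n) lebesgue_measure (A i))%E.
Proof.
elim: n A => [|n IH] A mA /=.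
  rewrite big_ord0 diracE (_ : _ \in _ = true)//.
  by apply/mem_set => -[].
rewrite big_ord_recl -(IH (fun i => A (lift ord0 i)))//.
rewrite /cons_measure /pushforward.
have mAS : measurable
    [set x : 'cV[R]_n | forall i, A (lift ord0 i) (x i 0)].
  rewrite [X in measurable X](_ : _ = \bigcap_(i in [set: 'I_n])
      ((fun x : 'cV[R]_n => x i 0) @^-1` A (lift ord0 i))); last first.
    by rewrite predeqE => x; split=> [Ax i _|Ax i]; [exact: Ax|exact: (Ax i)].
  apply: fin_bigcap_measurable => // i _.
  rewrite -[X in measurable X]setTI.
  exact: (measurable_mx_coord i 0 measurableT (mA _)).
rewrite -product_measure1E//.
congr (_ _); rewrite predeqE => -[a x]; split=> /= [Aax|[Aa Ax] i].
  split; first by have := Aax ord0; rewrite cons_cV0.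
  by move=> i; have := Aax (lift ord0 i); rewrite cons_cVS.
by case: (unliftP ord0 i) => [k ->|->]; rewrite ?cons_cVS ?cons_cV0.
Qed.

End lebesgue_measure_cV.

Section log_convexity.
Context {R : realType} {E : lmodType R}.
Local Open Scope convex_scope.

(* Same shape as the library's convex_function, with the inequality reversed. *)
Definition concave_function (D : set (convex_lmodType E))
    (h : convex_lmodType E -> R^o) :=
  forall t : {i01 R}, {in D &, forall x y : convex_lmodType E,
    (h x <| t |> h y <= h (x <| t |> y))%R}.

Definition log_convex (h : E -> R) :=
  (forall x, 0 < h x) /\ @convex_function R E setT (fun x => ln (h x)).

Definition log_concave (h : E -> R) :=
  (forall x, 0 < h x) /\ concave_function setT (fun x => ln (h x)).

End log_convexity.

Section multivariate_normal.
Context {R : realType} {n : nat}.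

Definition sym_posdefmx (S : 'M[R]_n) :=
  S^T = S /\ forall v : 'cV[R]_n, v != 0 -> 0 < (v^T *m S *m v) 0 0.

Definition multivariate_normal_pdf (mu : 'cV[R]_n) (S : 'M[R]_n)
    (x : 'cV[R]_n) : R :=
  ((2 * pi) `^ (n%:R / 2) * Num.sqrt (\det S))^-1 *
  expR (- 2^-1 * ((x - mu)^T *m invmx S *m (x - mu)) 0 0).

Definition is_multivariate_normal_pdf (f : 'cV[R]_n -> R) :=
  exists (mu : 'cV[R]_n) (S : 'M[R]_n),
    sym_posdefmx S /\ forall x, f x = multivariate_normal_pdf mu S x.

End multivariate_normal.

(* Main.v *)
Require Import Defs.
From mathcomp Require Import all_boot all_order all_algebra.
From mathcomp Require Import all_classical all_reals all_analysis.
From mathcomp Require Import measurable_realfun ring lra.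

Set Implicit Arguments.
Unset Strict Implicit.
Unset Printing Implicit Defensive.

Import Order.TTheory GRing.Theory Num.Theory.
Import numFieldNormedType.Exports.

Local Open Scope classical_set_scope.
Local Open Scope ring_scope.

(** Write g_y(x) = f(x + y) / f(x) and phi = ln f, so that
    ln g_y(x) = phi(x + y) - phi(x) is an increment of phi.

    Convexity self-improves to log-convexity because g_y is a product of k
    ratios with the small shift y / k. Writing u for the logarithm of one of
    these, convexity of g_(y/k) at t a + (1 - t) b gives the log-convexity
    inequality for u up to an error of order (u(a) - u(b))^2
    ([ln_conv_le]). Now u(a) - u(b) is also an increment, over a step of
    length 1 / k along the direction y, of ln g_(a - b). As both g_(a - b) and
    its inverse (a translate of g_(b - a)) are convex, this function is
    Lipschitz on segments ([ln_lipschitz_of_convex]), so each error is O(1/k^2)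
    and the sum of the k errors vanishes in the limit.

    Log-convexity for all y and log-concavity for all y are the same thing,
    since ln g_(-y)(x + y) = - ln g_y(x). Hence either of them makes every
    increment of phi affine, so that phi is a constant plus a quadratic form
    plus an additive function; the latter is measurable, hence linear
    ([measurable_additive_linear], [affine_increments_quadratic]).

    It remains to see which functions exp(c - x^T A x / 2 + b . x) are
    probability densities. Integrating out the first coordinate turns A into a
    Schur complement and is only possible when the pivot is positive; by
    induction, integrability forces A to be positive definite, and the integral
    has its familiar value ([gaussian_integral]). This identifies f as the
    normal density of covariance A^-1 and mean A^-1 b. Conversely the ratios of a
    normal density are exponentials of affine functions, hence convex. *)

(** * Convexity of ratios implies their log-convexity *)

Section convexity.
Context {R : realType} {E : lmodType R}.
Implicit Types (h : E -> R) (x y z : E) (t : R).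

Lemma conv_translate t x y z :
  t *: (x + z) + (1 - t) *: (y + z) = t *: x + (1 - t) *: y + z.
Proof. by rewrite !scalerDr addrACA -scalerDl subrKC scale1r. Qed.

Lemma convex_setTP h : @convex_function R E setT h <->
  forall t x y, 0 <= t <= 1 -> h (t *: x + (1 - t) *: y) <= t * h x + (1 - t) * h y.
Proof.
split=> [ch t x y /andP[t0 t1]|ch t x y _ _].
  by apply: (ch (Itv01 t0 t1)); rewrite inE.
by apply: (ch t%:num); rewrite ge0 le1.
Qed.

Lemma concave_setTP h : @concave_function R E setT h <->
  forall t x y, 0 <= t <= 1 -> t * h x + (1 - t) * h y <= h (t *: x + (1 - t) *: y).
Proof.
split=> [ch t x y /andP[t0 t1]|ch t x y _ _].
  by apply: (ch (Itv01 t0 t1)); rewrite inE.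
by apply: (ch t%:num); rewrite ge0 le1.
Qed.

End convexity.

Section scalar_estimates.
Context {R : realType}.
Implicit Types (x p q s t : R) (G : R -> R).

Lemma ln_lerBV p q : 0 < p -> 0 < q -> ln p - ln q <= (p - q) / q.
Proof.
move=> p0 q0; rewrite -ln_div ?posrE// -[p / q](addrNK 1) (addrC _ 1).
rewrite (_ : (p - q) / q = p / q - 1); last by rewrite mulrBl divff ?gt_eqF.
by apply: le_ln1Dx; rewrite ltrBrDl subrr divr_gt0.
Qed.

Lemma expR_le_quadratic x : x <= 1 / 2 -> expR x <= 1 + x + 2 * x ^+ 2.
Proof.
move=> x2.
have x1 : 0 < 1 - x by lra.
have : expR x <= (1 - x)^-1.
  by rewrite -[x]opprK expRN lef_pV2 ?posrE ?expR_gt0 ?opprK ?expR_ge1Dx.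
move=> /le_trans; apply; rewrite -[_^-1]mul1r ler_pdivrMr//.
have -> : (1 + x + 2 * x ^+ 2) * (1 - x) = 1 + x ^+ 2 * (1 - 2 * x) by ring.
by rewrite lerDl mulr_ge0 ?sqr_ge0//; lra.
Qed.

(** To first order around p = q, the logarithm of a weighted arithmetic mean is
    the weighted mean of the logarithms: the defect is quadratic in
    ln p - ln q. The concavity of ln only gives the opposite inequality. *)
Lemma ln_conv_le p q t : 0 < p -> 0 < q -> 0 <= t <= 1 ->
  `|ln p - ln q| <= 1 / 2 ->
  ln (t * p + (1 - t) * q) <=
  t * ln p + (1 - t) * ln q + 2 * (ln p - ln q) ^+ 2.
Proof.
move=> p0 q0 /andP[t0 t1] pq; set r := ln p - ln q.
have /expR_le_quadratic re : r <= 1 / 2 by apply: le_trans pq; exact: ler_norm.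
have pE : p = q * expR r by rewrite expRB !lnK ?posrE// mulrC divfK ?gt_eqF.
have q'0 : 0 < t * p + (1 - t) * q.
  have [->|t0'] := eqVneq t 0; first by rewrite mul0r add0r subr0 mul1r.
  by rewrite ltr_wpDr ?mulr_ge0 ?subr_ge0 ?(ltW q0)// mulr_gt0// lt0r t0'.
have := ln_lerBV q'0 q0.
have -> : (t * p + (1 - t) * q - q) / q = t * (expR r - 1).
  by rewrite [in X in X / _]pE; field; rewrite gt_eqF.
have : t * (expR r - 1) <= t * (r + 2 * r ^+ 2) by rewrite ler_wpM2l//; lra.
have : t * (2 * r ^+ 2) <= 2 * r ^+ 2 by rewrite ler_piMl// mulr_ge0// sqr_ge0.
rewrite [t * (r + _)]mulrDr.
have -> : t * r = t * ln p - t * ln q by rewrite /r mulrBr.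
lra.
Qed.

Lemma ler_convl s p q : 0 <= s <= 1 -> 0 < p -> 0 < q ->
  s * p + (1 - s) * q <= p + q.
Proof. by move=> /andP[s0 s1] p0 q0; rewrite lerD// ler_piMl ?(ltW p0) ?(ltW q0)//; lra. Qed.

(** A positive convex function has slopes on [0, 1] controlled by its values at
    -1 and 2 (compare with chords ending there, and drop the nonnegative values
    subtracted). Convexity of the inverse keeps G away from 0 on [0, 1], so the
    bound passes to the logarithm. *)
Lemma ln_lipschitz_of_convex G : (forall s, 0 < G s) ->
  (forall t x y, 0 <= t <= 1 ->
    G (t * x + (1 - t) * y) <= t * G x + (1 - t) * G y) ->
  (forall t x y, 0 <= t <= 1 ->
    (G (t * x + (1 - t) * y))^-1 <= t * (G x)^-1 + (1 - t) * (G y)^-1) ->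
  exists2 K, 0 <= K & forall s t, 0 <= s -> s <= t -> t <= 1 ->
    `|ln (G t) - ln (G s)| <= K * (t - s).
Proof.
move=> G0 cG cGV.
have GV0 s : 0 < (G s)^-1 by rewrite invr_gt0.
pose M := (G 0)^-1 + (G 1)^-1.
have GVM s : 0 <= s <= 1 -> (G s)^-1 <= M.
  move=> s01; have := cGV s 1 0 s01; rewrite mulr1 mulr0 addr0 => /le_trans.
  by apply; rewrite /M [leRHS]addrC ler_convl.
have M0 : 0 < M by rewrite addr_gt0.
pose L := G 2 + G (- 1).
have L0 : 0 < L by rewrite addr_gt0.
exists (L * M); first by rewrite mulr_ge0 ?ltW.
move=> s t s0 st t1.
have up : G t - G s <= L * (t - s).
  have s2 : 0 < 2 - s by lra.
  pose w := (t - s) / (2 - s).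
  have ws : w * (2 - s) = t - s by rewrite /w divfK// gt_eqF.
  have w0 : 0 <= w by apply: divr_ge0; [rewrite subr_ge0|exact: ltW].
  have w1 : w <= t - s by rewrite /w ler_pdivrMr// ler_peMr//; lra.
  have w01 : 0 <= w <= 1 by rewrite w0/=; lra.
  have := cG w 2 s w01; have -> : w * 2 + (1 - w) * s = t.
    by rewrite -[RHS](subrK s) -ws; ring.
  have : w * G 2 <= (t - s) * G 2 by rewrite ler_wpM2r// ltW.
  have : 0 <= w * G s by rewrite mulr_ge0// ltW.
  have : 0 <= (t - s) * G (- 1) by rewrite mulr_ge0 ?subr_ge0// ltW.
  rewrite /L; lra.
have dn : G s - G t <= L * (t - s).
  have s2 : 0 < t + 1 by lra.
  pose w := (t - s) / (t + 1).
  have ws : w * (t + 1) = t - s by rewrite /w divfK// gt_eqF.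
  have w0 : 0 <= w by apply: divr_ge0; [rewrite subr_ge0|exact: ltW].
  have w1 : w <= t - s by rewrite /w ler_pdivrMr// ler_peMr//; lra.
  have w01 : 0 <= w <= 1 by rewrite w0/=; lra.
  have := cG w (- 1) t w01; have -> : w * (- 1) + (1 - w) * t = s.
    by rewrite -[RHS](subKr t) -ws; ring.
  have : w * G (- 1) <= (t - s) * G (- 1) by rewrite ler_wpM2r// ltW.
  have : 0 <= w * G t by rewrite mulr_ge0// ltW.
  have : 0 <= (t - s) * G 2 by rewrite mulr_ge0 ?subr_ge0// ltW.
  rewrite /L; lra.
have Lts : 0 <= L * (t - s) by rewrite mulr_ge0 ?subr_ge0// ltW.
have aux u v : 0 <= v <= 1 -> G u - G v <= L * (t - s) ->
    ln (G u) - ln (G v) <= L * M * (t - s).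
  move=> v01 uv; apply: (le_trans (ln_lerBV (G0 u) (G0 v))).
  rewrite mulrAC; apply: (@le_trans _ _ (L * (t - s) * (G v)^-1)).
    by rewrite ler_wpM2r// ltW.
  by rewrite ler_wpM2l// GVM.
have s01 : 0 <= s <= 1 by rewrite s0 (le_trans st).
have t01 : 0 <= t <= 1 by rewrite t1 (le_trans s0).
by rewrite ler_norml; rewrite lerNl opprB !aux.
Qed.

End scalar_estimates.

Section ratio.
Context {R : realType} {E : lmodType R} (f : E -> R) (f_gt0 : forall x, 0 < f x).
Local Notation phi := (fun x => ln (f x)).
Implicit Types (x y a b : E) (t : R).

Lemma ratio_gt0 y x : 0 < f (x + y) / f x.
Proof. by rewrite divr_gt0. Qed.

Lemma ln_ratio y x : ln (f (x + y) / f x) = ln (f (x + y)) - ln (f x).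
Proof. by rewrite ln_div ?posrE. Qed.

(** The increment of ln (f (. + y / k)) - ln f between b and a, taken at the j-th
    subdivision point, is a double difference of ln f, symmetric in the shifts
    y / k and a - b. Read in the other order it is an increment of
    s |-> ln (f (a + s y) / f (b + s y)), to which [ln_lipschitz_of_convex]
    applies. *)
Lemma ratio_increments_lipschitz y a b :
  (forall z, @convex_function R E setT (fun x => f (x + z) / f x)) ->
  exists2 K, 0 <= K & forall (k j : nat), (j < k)%N ->
   `|(ln (f (a + (j.+1%:R / k%:R) *: y)) - ln (f (a + (j%:R / k%:R) *: y))) -
     (ln (f (b + (j.+1%:R / k%:R) *: y)) - ln (f (b + (j%:R / k%:R) *: y)))|
   <= K / k%:R.
Proof.
move=> cf.
have ch z : forall t x x', 0 <= t <= 1 -> _ := (convex_setTP _).1 (cf z).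
have line (c d : E) t u v : c + (t * u + (1 - t) * v) *: d =
    t *: (c + u *: d) + (1 - t) *: (c + v *: d).
  by rewrite !scalerDr addrACA -scalerDl subrKC scale1r scalerDl !scalerA.
pose G s := f (a + s *: y) / f (b + s *: y).
have GE s : G s = f ((b + s *: y) + (a - b)) / f (b + s *: y).
  by rewrite /G [_ + (a - b)]addrC [_ + (b + _)]addrA subrK.
have GVE s : (G s)^-1 = f ((a + s *: y) + (b - a)) / f (a + s *: y).
  by rewrite /G invf_div [_ + (b - a)]addrC [_ + (a + _)]addrA subrK.
have [|||K K0 GK] := @ln_lipschitz_of_convex R G.
- by move=> s; rewrite divr_gt0.
- by move=> t u v t01; rewrite !GE line; exact: ch.
- by move=> t u v t01; rewrite !GVE line; exact: ch.
exists K => // k j jk.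
have k0 : 0 < k%:R :> R by rewrite ltr0n (leq_trans _ jk).
have := GK (j%:R / k%:R) (j.+1%:R / k%:R).
rewrite /G !ln_div ?posrE// -mulrBl -natrB// subSnn mul1r.
have -> (p q u v : R) : p - q - (u - v) = p - u - (q - v) by ring.
apply.
- by rewrite divr_ge0 // ltW.
- by rewrite ler_pM2r ?invr_gt0// ler_nat.
- by rewrite ler_pdivrMr// mul1r ler_nat.
Qed.

(** The logarithm of the ratio with shift y telescopes into k terms with shift
    y / k. Each satisfies the log-convexity inequality up to 2 (K / k)^2, so the
    sum does up to 2 K^2 / k, for every k. *)
Lemma convex_ratio_log_convex :
  (forall y, @convex_function R E setT (fun x => f (x + y) / f x)) ->
  forall y, log_convex (fun x => f (x + y) / f x).
Proof.
move=> cf y; split=> [x|]; first exact: ratio_gt0.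
apply/convex_setTP => t a b t01.
have [K K0 HK] := ratio_increments_lipschitz y a b cf.
apply/ler_addgt0Pr => e e0.
pose c := t *: a + (1 - t) *: b.
(* K / k <= 1 / 2 is required by ln_conv_le; the total error 2 K^2 / k must be
   at most e. *)
pose k := (Num.bound (2 * K) + Num.bound (2 * K ^+ 2 / e)).+1.
have k0 : 0 < k%:R :> R by rewrite ltr0n.
have K2 : 0 <= 2 * K ^+ 2 / e by rewrite divr_ge0 ?(ltW e0)// mulr_ge0// sqr_ge0.
have kK : K / k%:R <= 1 / 2.
  have : 2 * K <= k%:R.
    apply: (le_trans (ltW (archi_boundP _))); first by rewrite mulr_ge0.
    by rewrite ler_nat /k -addnS leq_addr.
  by rewrite ler_pdivrMr//; lra.
have ke : k%:R * (2 * (K / k%:R) ^+ 2) <= e.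
  have -> : k%:R * (2 * (K / k%:R) ^+ 2) = 2 * K ^+ 2 / k%:R.
    by field; rewrite gt_eqF.
  rewrite ler_pdivrMr// [leRHS]mulrC -ler_pdivrMr//.
  apply: (le_trans (ltW (archi_boundP _))) => //.
  by rewrite ler_nat /k -addSn leq_addl.
pose u x (j : nat) := ln (f (x + (j%:R / k%:R) *: y)).
have sumu x : ln (f (x + y) / f x) = \sum_(0 <= j < k) (u x j.+1 - u x j).
  by rewrite telescope_sumr// /u divff ?gt_eqF// scale1r mul0r scale0r addr0 ln_ratio.
rewrite !sumu; apply: (@le_trans _ _ (\sum_(0 <= j < k)
    (t * (u a j.+1 - u a j) + (1 - t) * (u b j.+1 - u b j) + 2 * (K / k%:R) ^+ 2))).
  rewrite [leLHS]big_nat [leRHS]big_nat; apply: ler_sum => j /= jk.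
  pose z := k%:R^-1 *: y.
  have uS x : u x j.+1 = ln (f (x + (j%:R / k%:R) *: y + z)).
    by rewrite /u -addrA -scalerDl -natr1 mulrDl mul1r.
  have uE x : u x j.+1 - u x j =
      ln (f (x + (j%:R / k%:R) *: y + z) / f (x + (j%:R / k%:R) *: y)).
    by rewrite uS ln_ratio.
  have Hab := HK k j jk; rewrite -!/(u _ _) in Hab.
  have /convex_setTP/(_ t (a + (j%:R / k%:R) *: y) (b + (j%:R / k%:R) *: y) t01) := cf z.
  have -> : t *: (a + (j%:R / k%:R) *: y) + (1 - t) *: (b + (j%:R / k%:R) *: y)
      = c + (j%:R / k%:R) *: y.
    by rewrite conv_translate.
  set p := f (a + _ + z) / _; set q := f (b + _ + z) / _ => cpq.
  have lp : ln p = u a j.+1 - u a j by rewrite uE.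
  have lq : ln q = u b j.+1 - u b j by rewrite uE.
  have p0 : 0 < p by rewrite divr_gt0.
  have q0 : 0 < q by rewrite divr_gt0.
  rewrite -lp -lq in Hab *; rewrite -/c uE.
  apply: (@le_trans _ _ (ln (t * p + (1 - t) * q))).
    by rewrite ler_ln ?posrE ?divr_gt0//; apply: lt_le_trans cpq; rewrite divr_gt0.
  apply: (le_trans (ln_conv_le p0 q0 t01 (le_trans Hab kK))).
  rewrite lerD2l ler_pM2l// -[leLHS]real_normK ?num_real//.
  by rewrite lerXn2r ?nnegrE// divr_ge0// ltW.
move: (2 * (K / k%:R) ^+ 2) ke => d ke.
rewrite [leLHS]big_split/= [X in X + _ <= _]big_split/= -!mulr_sumr lerD2l.
by rewrite sumr_const_nat subn0 -mulr_natl.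
Qed.

Lemma log_convex_ratio_log_concave :
  (forall y, log_convex (fun x => f (x + y) / f x)) ->
  forall y, log_concave (fun x => f (x + y) / f x).
Proof.
move=> lcf y; split=> [x|]; first exact: ratio_gt0.
apply/concave_setTP => t a b t01.
have [_ /convex_setTP/(_ t (a + y) (b + y) t01)] := lcf (- y).
rewrite !ln_ratio !addrK.
rewrite conv_translate addrK.
by nra.
Qed.

(** Applying log-concavity to the shift -y at the points a + y and b + y reverses
    the inequality obtained from the shift y. *)
Lemma log_concave_ratio_affine :
  (forall y, log_concave (fun x => f (x + y) / f x)) ->
  forall y t a b, 0 <= t <= 1 -> let u x := ln (f (x + y)) - ln (f x) in
    u (t *: a + (1 - t) *: b) = t * u a + (1 - t) * u b.
Proof.
move=> lcf y t a b t01; apply/eqP; rewrite eq_le; apply/andP; split; last first.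
  have [_ /concave_setTP/(_ t a b t01)] := lcf y.
  by rewrite !ln_ratio.
have [_ /concave_setTP/(_ t (a + y) (b + y) t01)] := lcf (- y).
rewrite !ln_ratio !addrK.
rewrite conv_translate addrK.
by nra.
Qed.

End ratio.

(** * Measurable additive functions on the line *)

Section cauchy_equation.
Context {R : realType}.
Notation mu := (@lebesgue_measure R).

Lemma lebesgue_measure_translation (s : R) (A : set (measurableTypeR R)) :
  measurable A -> mu ((fun x => x + s) @^-1` A) = mu A.
Proof.
have ms : measurable_fun setT
    (fun x : measurableTypeR R => (x : R) + s : measurableTypeR R).
  exact: measurable_funD.
pose nu : {measure set (measurableTypeR R) -> \bar R} :=
  measure_function_pushforward__canonical__measure_function_Measure mu ms.
move=> mA; apply/esym/(@lebesgue_measure_unique R nu) => //.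
move=> _ /ocitvP[->|[[a b]/= ab ->]]; first by rewrite !measure0.
rewrite /nu/= /pushforward.
have -> : (fun x => x + s) @^-1` `]a, b]%classic = `]a - s, b - s]%classic.
  by apply/seteqP; split => x; rewrite /= !in_itv/= ltrBlDr lerBrDr.
rewrite !lebesgue_measure_itv/= !lte_fin ab ltrD2r ab -!EFinB; congr EFin.
lra.
Qed.

Context (a : R -> R) (aD : {morph a : s t / s + t}).
Hypothesis ma : measurable_fun [set: R] a.

(** Steinhaus argument: the set E_N of points of [0, 1] where |a| <= N has
    measure more than 2/3 for N large. For s in [0, 1/4], E_N and its translate
    by s both lie in [0, 5/4], too short for two disjoint sets of that measure;
    a common point x gives a(s) = a(x) - a(x - s). *)
Lemma measurable_additive_bounded :
  exists M, forall s, 0 <= s -> s <= 1 / 4 -> `|a s| <= M.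
Proof.
pose E (N : nat) : set R := `[0, 1]%classic `&` (a @^-1` `[- N%:R, N%:R]%classic).
have mE N : measurable (E N).
  by rewrite -[X in measurable (_ `&` X)]setTI; apply: measurableI => //; exact: ma.
have UE : \bigcup_N E N = `[0, 1]%classic.
  apply/seteqP; split=> [x [N _ []]//|x x01].
  exists (Num.bound `|a x|) => //; split=> //=.
  rewrite in_itv/= -ler_norml ltW//; exact: archi_boundP.
have [N EN] : exists N, ((2 / 3)%:E < mu (E N))%E.
  have ndE : {homo E : p q / (p <= q)%N >-> (p <= q)%O}.
    move=> p q pq; apply/subsetPset => x [x01 /=]; rewrite !in_itv/= -!ler_norml.
    by move=> ax; split => //; rewrite /= in_itv/= -ler_norml (le_trans ax)// ler_nat.
  have cvE : mu (E N) @[N --> \oo] --> 1%E.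
    have -> : 1%E = mu (\bigcup_N E N).
      by rewrite UE lebesgue_measure_itv/= lte01 oppr0 adde0.
    apply: nondecreasing_cvg_mu => //; rewrite UE; exact: measurable_itv.
  have : \forall N \near \oo, ((2 / 3)%:E < mu (E N))%E.
    apply: (cvE [set y | ((2 / 3)%:E < y)%E]); apply: open_nbhs_nbhs.
    by split; [exact: open_ereal_gt_ereal|rewrite /= lte_fin; lra].
  by case=> N _ /(_ N (leqnn N)); exists N.
exists (N%:R + N%:R) => s s0 s4.
pose Es : set R := (fun x : R => x + - s) @^-1` E N.
have [x [[_ ax] [_ asx]]] : E N `&` Es !=set0.
  apply/set0P/eqP => disj.
  have mEs : measurable Es.
    rewrite -[X in measurable X]setTI.
    have: measurable_fun setT (fun x : measurableTypeR R => x + - s).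
      exact: measurable_funD.
    by apply.
  have : (mu (E N `|` Es) <= mu `[0%R, (5 / 4)%R]%classic)%E.
    apply: le_measure; [|by apply: mem_set; exact: measurable_itv|].
      by apply: mem_set; apply: measurableU; [exact: mE|exact: mEs].
    move=> x [[]|[]]/=; rewrite !in_itv/= => /andP[x0 x1] _; lra.
  have muEs : mu Es = mu (E N) by apply: lebesgue_measure_translation; exact: mE.
  rewrite measureU; [|exact: mE|exact: mEs|exact: disj].
  rewrite [X in (_ + X <= _)%E]muEs lebesgue_measure_itv/=.
  rewrite lte_fin divr_gt0// sube0 => muE.
  have : ((2 / 3)%:E + (2 / 3)%:E < (5 / 4 : R)%:E)%E.
    by apply: lt_le_trans muE; rewrite lteD.
  by rewrite -EFinD lte_fin; lra.
move: ax asx; rewrite /= !in_itv/= -!ler_norml => ax asx.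
have -> : a s = a x - a (x - s) by apply/eqP; rewrite eq_sym subr_eq -aD subrKC.
by rewrite (le_trans (ler_normB _ _))// lerD.
Qed.

Lemma additiveMn (n : nat) t : a (n%:R * t) = n%:R * a t.
Proof.
have a0 : a 0 = 0 by apply/eqP; rewrite -(inj_eq (addrI (a 0))) -aD !addr0.
elim: n => [|n IH]; first by rewrite !mul0r.
by rewrite -natr1 !mulrDl !mul1r aD IH.
Qed.

(** t |-> a(t) - t a(1) is additive, vanishes on the multiples of 1/4 and is
    bounded near 0, hence bounded on the half line; an additive function which
    is bounded there is 0, as its value at n t is n times its value at t. *)
Lemma measurable_additive_linear t : a t = t * a 1.
Proof.
have a0 : a 0 = 0 by have := additiveMn 0 0; rewrite !mul0r.
have aN s : a (- s) = - a s.
  by apply/eqP; rewrite -addr_eq0 -aD addNr a0.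
have [M aM] := measurable_additive_bounded.
wlog t0 : t / 0 <= t.
  move=> H; have [/H//|/ltW t0] := leP 0 t.
  by apply: oppr_inj; rewrite -aN H ?oppr_ge0// mulNr.
(* every s >= 0 is an integer multiple of 1/4 plus a remainder in [0, 1/4] *)
have bnd s : 0 <= s -> `|a s - s * a 1| <= M + `|a 1|.
  move=> s0; pose k := Num.trunc (4 * s).
  have /andP[ks sk] : k%:R <= 4 * s < k.+1%:R.
    by apply: truncn_itv; rewrite mulr_ge0.
  rewrite -natr1 in sk.
  pose r := s - k%:R * (1 / 4).
  have a14 : 4 * a (1 / 4) = a 1.
    by rewrite -(additiveMn 4); congr a; lra.
  have as_ : a s = k%:R * a (1 / 4) + a r by rewrite -additiveMn -aD /r subrKC.
  have -> : a s - s * a 1 = a r - r * a 1.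
    by rewrite as_ /r -a14; field.
  rewrite (le_trans (ler_normB _ _))// lerD//; first by rewrite aM// /r; lra.
  rewrite normrM ler_piMl// ger0_norm /r; lra.
apply/eqP; rewrite -subr_eq0 -normr_le0; apply/ler_addgt0Pr => e e0.
rewrite add0r.
pose n := (Num.bound ((M + `|a 1|) / e)).+1.
have n0 : 0 < n%:R :> R by rewrite ltr0n.
have := bnd (n%:R * t); rewrite mulr_ge0// additiveMn -mulrA -mulrBr normrM.
rewrite ger0_norm// => /(_ isT) nb.
rewrite -(ler_pM2l n0) (le_trans nb)// mulrC -ler_pdivrMl// mulrC.
have Me0 : 0 <= (M + `|a 1|) / e.
  rewrite divr_ge0 ?(ltW e0)// addr_ge0//.
  by apply: (le_trans (normr_ge0 (a 0))); apply: aM; lra.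
by rewrite (le_trans (ltW (archi_boundP Me0)))// ler_nat.
Qed.

End cauchy_equation.

(** * Quadratic forms and Schur complements *)

Section dot_product.
Context {R : realType}.
Implicit Types (n : nat) (t s p : R).

Definition dot n (u v : 'cV[R]_n) : R := (u^T *m v) 0 0.

Lemma dotE n (u v : 'cV[R]_n) : dot u v = \sum_i u i 0 * v i 0.
Proof. by rewrite /dot mxE; apply: eq_bigr => i _; rewrite mxE. Qed.

Lemma dotC n (u v : 'cV[R]_n) : dot u v = dot v u.
Proof. by rewrite !dotE; apply: eq_bigr => i _; rewrite mulrC. Qed.

Lemma dotDl n (u v w : 'cV[R]_n) : dot (u + v) w = dot u w + dot v w.
Proof. by rewrite /dot linearD mulmxDl mxE. Qed.

Lemma dotDr n (u v w : 'cV[R]_n) : dot w (u + v) = dot w u + dot w v.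
Proof. by rewrite /dot mulmxDr mxE. Qed.

Lemma dotZl n t (u v : 'cV[R]_n) : dot (t *: u) v = t * dot u v.
Proof. by rewrite /dot linearZ -scalemxAl mxE. Qed.

Lemma dotZr n t (u v : 'cV[R]_n) : dot u (t *: v) = t * dot u v.
Proof. by rewrite dotC dotZl dotC. Qed.

Lemma dotBl n (u v w : 'cV[R]_n) : dot (u - v) w = dot u w - dot v w.
Proof. by rewrite dotDl -scaleN1r dotZl mulN1r. Qed.

Lemma dotBr n (u v w : 'cV[R]_n) : dot w (u - v) = dot w u - dot w v.
Proof. by rewrite dotC dotBl !(dotC w). Qed.

Lemma dot_mulmx n (A : 'M[R]_n) u v : dot (A *m u) v = dot u (A^T *m v).
Proof. by rewrite /dot trmx_mul mulmxA. Qed.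

(** Uncurried, this is definitionally the map cons_cV that transports the product
    measure to R^(n+1). *)
Definition col_cons n t (u : 'cV[R]_n) : 'cV[R]_n.+1 := col_mx t%:M u.

Lemma col_consP n (v : 'cV[R]_n.+1) : exists t u, v = col_cons t u.
Proof.
exists (usubmx (v : 'cV_(1 + n)) 0 0), (dsubmx (v : 'cV_(1 + n))).
by rewrite /col_cons -mx11_scalar vsubmxK.
Qed.

Lemma dot_col_cons n t s (u v : 'cV[R]_n) : dot (col_cons t u) (col_cons s v) = t * s + dot u v.
Proof.
rewrite /dot /col_cons (@tr_col_mx _ 1 n) (@mul_row_col _ 1 1 n) tr_scalar_mx -scalar_mxM mxE.
by rewrite mxE eqxx.
Qed.

Definition bordered n p (r : 'cV[R]_n) (S : 'M[R]_n) : 'M[R]_n.+1 :=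
  block_mx p%:M r^T r S.

Lemma sym_bordered n (A : 'M[R]_n.+1) : A^T = A ->
  exists p r S, A = bordered p r S /\ S^T = S.
Proof.
move=> At; have := At.
rewrite -[A in A^T](@submxK _ 1 n 1 n) (@tr_block_mx _ 1 n 1 n).
rewrite -[in RHS](@submxK _ 1 n 1 n A) => /(@eq_block_mx _ 1 n 1 n)[_ _ Eur Edr].
exists (@ulsubmx _ 1 n 1 n A 0 0), (@dlsubmx _ 1 n 1 n A), (@drsubmx _ 1 n 1 n A).
split=> //; rewrite /bordered -mx11_scalar -Eur trmxK.
by rewrite Eur (@submxK _ 1 n 1 n).
Qed.

Lemma mul_bordered_col_cons n p r (S : 'M[R]_n) t u :
  bordered p r S *m col_cons t u = col_cons (p * t + dot r u) (t *: r + S *m u).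
Proof.
rewrite /bordered /col_cons (@mul_block_col _ 1 n 1 n 1); apply: (f_equal2 (@col_mx R 1 n 1)).
  by rewrite -scalar_mxM [r^T *m u]mx11_scalar -raddfD.
by rewrite mul_mx_scalar.
Qed.

Lemma quad_bordered n p r (S : 'M[R]_n) t u :
  dot (col_cons t u) (bordered p r S *m col_cons t u) =
  p * t ^+ 2 + 2 * t * dot r u + dot u (S *m u).
Proof. by rewrite mul_bordered_col_cons dot_col_cons dotDr dotZr (dotC u r); ring. Qed.

Definition schur n p (r : 'cV[R]_n) (S : 'M[R]_n) := S - p^-1 *: (r *m r^T).

Lemma schurE n p r (S : 'M[R]_n) u :
  schur p r S *m u = S *m u - (dot r u / p) *: r.
Proof.
rewrite mulmxBl -scalemxAl -mulmxA [r^T *m u]mx11_scalar mul_mx_scalar.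
by rewrite scalerA mulrC.
Qed.

Lemma schur_sym n p r (S : 'M[R]_n) : S^T = S -> (schur p r S)^T = schur p r S.
Proof. by move=> St; rewrite /schur linearB linearZ/= trmx_mul trmxK St. Qed.

Lemma det_bordered n p r (S : 'M[R]_n) : p != 0 ->
  \det (bordered p r S) = p * \det (schur p r S).
Proof.
move=> p0.
have -> : bordered p r S =
    block_mx 1%:M 0 (p^-1 *: r) 1%:M *m block_mx p%:M r^T 0 (schur p r S).
  rewrite (@mulmx_block _ 1 n 1 n 1 n) !mul1mx !mul0mx !addr0.
  by rewrite mul_mx_scalar scalerA divff// scale1r -scalemxAl subrKC.
rewrite det_mulmx (@det_lblock _ 1 n) (@det_ublock _ 1 n) !det1 !mul1r.
by rewrite det_scalar1.
Qed.

Lemma sym_posdefE n (A : 'M[R]_n) :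
  sym_posdefmx A <-> A^T = A /\ forall v, v != 0 -> 0 < dot v (A *m v).
Proof. by rewrite /sym_posdefmx /dot; split=> -[? H]; split=> // v /H; rewrite mulmxA. Qed.

(** Completing the square in the first coordinate writes the bordered form as
    p (t + r . u / p)^2 plus the form of the Schur complement at u. *)
Lemma bordered_posdef n p r (S : 'M[R]_n) : S^T = S -> 0 < p ->
  sym_posdefmx (schur p r S) -> sym_posdefmx (bordered p r S).
Proof.
move=> St p0 /sym_posdefE[_ SP]; apply/sym_posdefE; split.
  by rewrite /bordered (@tr_block_mx _ 1 n 1 n) tr_scalar_mx trmxK St.
move=> v; have [t [u ->]] := col_consP v => v0.
have -> : dot (col_cons t u) (bordered p r S *m col_cons t u) =
    p * (t + dot r u / p) ^+ 2 + dot u (schur p r S *m u).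
  rewrite quad_bordered schurE dotBr dotZr (dotC u r).
  by field; rewrite gt_eqF.
have [u0|u0] := eqVneq u 0.
  rewrite u0 mulmx0 /dot !mulmx0 mxE mul0r !addr0 mulr_gt0// exprn_even_gt0//=.
  by apply: contra_neq v0 => ->; rewrite u0 /col_cons raddf0 (@col_mx0 _ 1 n).
by rewrite ltr_wpDl ?SP// mulr_ge0 ?sqr_ge0// ltW.
Qed.

End dot_product.

(** * The Gaussian integral on R^n *)

Section gaussian_integral.
Context {R : realType}.
Notation mu := (@lebesgue_measure R).

Lemma measurable_dot n d (T : measurableType d) (g h : T -> 'cV[R]_n) :
  measurable_fun setT g -> measurable_fun setT h ->
  measurable_fun setT (fun x => dot (g x) (h x)).
Proof.
move=> mg mh; under eq_fun do rewrite dotE.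
apply: measurable_sum => i; apply: measurable_funM.
  exact: (measurableT_comp (measurable_mx_coord i 0)).
exact: (measurableT_comp (measurable_mx_coord i 0)).
Qed.

Lemma measurable_mulmx n (A : 'M[R]_n) :
  measurable_fun setT (fun x : 'cV[R]_n => A *m x).
Proof.
apply: measurable_fun_mx => i j; under eq_fun do rewrite mxE.
apply: measurable_sum => k; apply: measurable_funM => //.
exact: measurable_mx_coord.
Qed.

Lemma measurable_quad n (A : 'M[R]_n) :
  measurable_fun setT (fun x : 'cV[R]_n => dot x (A *m x)).
Proof. by apply: measurable_dot => //; exact: measurable_mulmx. Qed.

Lemma lebesgue_measure_cV_setT_neq0 n :
  lebesgue_measure_cV n [set: 'cV[R]_n] != 0%E.
Proof.
have -> : [set: 'cV[R]_n] = [set x | forall i, [set: measurableTypeR R] (x i 0)].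
  by apply/seteqP; split.
rewrite (lebesgue_measure_cV_box (A := fun=> setT))// gt_eqF//.
apply: (big_ind (fun x => 0 < x)%E); [exact: lte01|exact: mule_gt0|move=> i _].
by rewrite -set_itvNyy lebesgue_measure_itv/= addye// ltry.
Qed.

Lemma integral_col_cons n (g : 'cV[R]_n.+1 -> \bar R) :
  measurable_fun setT g -> (forall x, 0 <= g x)%E ->
  (\int[lebesgue_measure_cV n.+1]_x g x =
   \int[lebesgue_measure_cV n]_x \int[mu]_t g (col_cons t x))%E.
Proof.
move=> mg g0.
transitivity (\int[pushforward (mu \x lebesgue_measure_cV n)
   (@cons_cV R n)]_x g x)%E; first by [].
rewrite ge0_integral_pushforward//; last exact: measurable_cons_cV.
rewrite fubini_tonelli2//; last by move=> x; exact: g0.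
by apply: measurableT_comp => //; exact: measurable_cons_cV.
Qed.

Lemma integral_csty_ge0 d (T : measurableType d)
  (nu : {measure set T -> \bar R}) D : measurable D -> nu D != 0%E ->
  (\int[nu]_(x in D) +oo = +oo)%E.
Proof.
move=> mD D0; rewrite (integral_cst nu mD +oo%E) gt0_mulye// lt0e D0.
exact: measure_ge0.
Qed.

Lemma measurable_gauss1 p s c :
  measurable_fun [set: R] (fun t => (expR (- 2^-1 * (p * t ^+ 2) + s * t + c))%:E).
Proof.
apply/measurable_EFinP; apply: measurableT_comp => //.
apply: measurable_funD => //; apply: measurable_funD; apply: measurable_funM => //.
by apply: measurable_funM => //; exact: measurable_funX.
Qed.

(** The exponent is at least c on the half line where s t >= 0. *)
Lemma integral_gauss1_infinite p s c : p <= 0 ->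
  (\int[mu]_t (expR (- 2^-1 * (p * t ^+ 2) + s * t + c))%:E = +oo)%E.
Proof.
move=> p0; apply/eqP; rewrite -leye_eq.
pose D : set R := if 0 <= s then `[0, +oo[%classic else `]-oo, 0]%classic.
have mD : measurable D by rewrite /D; case: ifP.
have Doo : mu D = +oo%E.
  rewrite /D; case: ifP => _; rewrite lebesgue_measure_itv/=.
    by rewrite ltry oppr0 adde0.
  by rewrite ltNyr add0e.
apply: (@le_trans _ _ (\int[mu]_(t in D) cst (expR c)%:E t)%E).
  by rewrite integral_cst// [X in (_ * X)%E]Doo gt0_muley// lte_fin expR_gt0.
apply: (@le_trans _ _ (\int[mu]_(t in D)
    (expR (- 2^-1 * (p * t ^+ 2) + s * t + c))%:E)%E).
  apply: ge0_le_integral => //.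
  - by move=> t _; rewrite lee_fin expR_ge0.
  - by apply: measurable_funTS; exact: measurable_gauss1.
  - move=> t Dt; rewrite lee_fin ler_expR lerDr addr_ge0//.
      have : 0 <= - p * t ^+ 2 by rewrite mulr_ge0 ?sqr_ge0// oppr_ge0.
      lra.
    move: Dt; rewrite /D; case: ifPn => sP /=; rewrite in_itv/= ?andbT => t0.
      exact: mulr_ge0.
    by rewrite mulr_le0// ltW// ltNge.
apply: ge0_subset_integral => //; first exact: measurable_gauss1.
Qed.

(** Up to a constant factor, the integrand is the normal density of mean s / p
    and variance 1 / p. *)
Lemma integral_gauss1 p s c : 0 < p ->
  (\int[mu]_t (expR (- 2^-1 * (p * t ^+ 2) + s * t + c))%:E =
   (Num.sqrt (2 * pi / p) * expR (2^-1 * (s ^+ 2 / p) + c))%:E)%E.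
Proof.
move=> p0; pose sigma := Num.sqrt p^-1.
have s0 : sigma != 0 by rewrite gt_eqF// sqrtr_gt0 invr_gt0.
have s2 : sigma ^+ 2 = p^-1 by rewrite sqr_sqrtr// invr_ge0 ltW.
pose K := Num.sqrt (2 * pi / p) * expR (2^-1 * (s ^+ 2 / p) + c).
have peakE : Num.sqrt (2 * pi / p) = (normal_peak sigma)^-1.
  by rewrite /normal_peak s2 invrK; congr Num.sqrt; rewrite mulr2n; ring.
transitivity (\int[mu]_t (K%:E * (normal_pdf (s / p) sigma t)%:E))%E.
  apply: eq_integral => t _; rewrite -EFinM; congr EFin.
  rewrite normal_pdfE// /K peakE mulrACA mulVf ?mul1r; last first.
    by rewrite gt_eqF// normal_peak_gt0.
  rewrite /normal_fun -expRD s2; congr expR; rewrite mulr2n; field.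
  by rewrite gt_eqF.
rewrite ge0_integralZl_EFin//.
- by rewrite integral_normal_pdf mule1.
- by move=> t _; rewrite lee_fin normal_pdf_ge0.
- by apply/measurable_EFinP; exact: measurable_normal_pdf.
- by rewrite mulr_ge0 ?expR_ge0 ?sqrtr_ge0.
Qed.

Lemma measurable_gauss n (A : 'M[R]_n) b :
  measurable_fun setT (fun x : 'cV[R]_n =>
    (expR (- 2^-1 * dot x (A *m x) + dot b x))%:E).
Proof.
apply/measurable_EFinP; apply: measurableT_comp => //; apply: measurable_funD.
  by apply: measurable_funM => //; exact: measurable_quad.
exact: measurable_dot.
Qed.

(** By Tonelli, integrate first in the first coordinate t, for fixed remaining
    coordinates x. If the pivot p is nonpositive every inner integral is
    infinite; otherwise it is a constant times the Gaussian function of x whose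
    matrix is the Schur complement of p, and induction applies. The value is
    expressed through a solution m of A m = b rather than through invmx A b,
    because solving this system by blocks matches the elimination of t. *)
Lemma gaussian_integral n (A : 'M[R]_n) (b : 'cV[R]_n) : A^T = A ->
  (\int[lebesgue_measure_cV n]_x
     (expR (- 2^-1 * dot x (A *m x) + dot b x))%:E < +oo)%E ->
  [/\ sym_posdefmx A, 0 < \det A & forall m, A *m m = b ->
    (\int[lebesgue_measure_cV n]_x
       (expR (- 2^-1 * dot x (A *m x) + dot b x))%:E =
     (Num.sqrt ((2 * pi) ^+ n / \det A) * expR (2^-1 * dot b m))%:E)%E].
Proof.
elim: n A b => [|n IH] A b.
  move=> At _; split; [|by rewrite det_mx00|].
    by split=> // v; rewrite (flatmx0 v) eqxx.
  move=> m _; rewrite integral_dirac//=; last exact: measurable_gauss.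
  rewrite diracT mul1e !dotE !big_ord0 !mulr0 addr0 expR0 det_mx00 expr0 divr1.
  by rewrite sqrtr1 mul1r.
move=> /sym_bordered[p [r [S [-> St]]]].
have [beta [b' ->]] := col_consP b.
rewrite integral_col_cons; last 2 first.
- exact: measurable_gauss.
- by move=> x; rewrite lee_fin expR_ge0.
have innerE x t : - 2^-1 * dot (col_cons t x) (bordered p r S *m col_cons t x) +
    dot (col_cons beta b') (col_cons t x) =
    - 2^-1 * (p * t ^+ 2) + (beta - dot r x) * t +
    (- 2^-1 * dot x (S *m x) + dot b' x).
  by rewrite quad_bordered dot_col_cons; field.
under eq_integral do under eq_integral do rewrite innerE.
have [p0|p0] := leP p 0.
  under eq_integral do rewrite integral_gauss1_infinite//.
  by rewrite integral_csty_ge0// lebesgue_measure_cV_setT_neq0.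
pose K := Num.sqrt (2 * pi / p) * expR (2^-1 * (beta ^+ 2 / p)).
have K0 : 0 < K.
  by rewrite mulr_gt0 ?expR_gt0// sqrtr_gt0 divr_gt0// mulr_gt0// pi_gt0.
pose b'' := b' - (beta / p) *: r.
have outerE (x : 'cV[R]_n) :
    (Num.sqrt (2 * pi / p) * expR (2^-1 * ((beta - dot r x) ^+ 2 / p) +
      (- 2^-1 * dot x (S *m x) + dot b' x)))%:E =
    (K%:E * (expR (- 2^-1 * dot x (schur p r S *m x) + dot b'' x))%:E)%E.
  rewrite -EFinM /K -(mulrA (Num.sqrt _)) -expRD; congr (_ * expR _)%:E.
  rewrite schurE dotBr dotZr /b'' dotBl dotZl (dotC x r); field.
  by rewrite gt_eqF.
under eq_integral do rewrite integral_gauss1// outerE.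
rewrite ge0_integralZl_EFin//; last 2 first.
- exact: measurable_gauss.
- exact: ltW.
move=> fin; have {}/IH-/(_ (schur_sym p r St))[] : (\int[lebesgue_measure_cV n]_x
    (expR (- 2^-1 * dot x (schur p r S *m x) + dot b'' x))%:E < +oo)%E.
  rewrite ltNge leye_eq; apply/eqP => Ioo; move: fin.
  by rewrite Ioo gt0_muley// lte_fin.
move=> SP detS SI; split; first exact: bordered_posdef.
  by rewrite det_bordered ?gt_eqF// mulr_gt0.
move=> m; have [m0 [m' ->]] := col_consP m.
rewrite mul_bordered_col_cons => /(@eq_col_mx _ 1 n 1)[/matrixP/(_ 0 0)].
rewrite !mxE eqxx !mulr1n => Hbeta Hb'.
have Hm : schur p r S *m m' = b''.
  rewrite schurE /b'' -Hb' -Hbeta mulrDl (mulrC p) mulfK ?gt_eqF//.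
  by rewrite scalerDl opprD addrA [m0 *: r + _]addrC addrK.
rewrite (SI _ Hm) -EFinM det_bordered ?gt_eqF//; congr EFin.
rewrite /K mulrACA -expRD -sqrtrM; last first.
  by rewrite divr_ge0 ?(ltW p0)// mulr_ge0// pi_ge0.
congr (Num.sqrt _ * expR _).
  by rewrite exprS invfM mulrACA.
rewrite dot_col_cons /b'' dotBl dotZl -Hbeta; field.
by rewrite gt_eqF.
Qed.

End gaussian_integral.

(** * Functions with affine increments are quadratic *)

Section affine_increments.
Context {R : realType}.

Lemma affine_linear (E : lmodType R) (w : E -> R) :
  (forall t a b, 0 <= t <= 1 ->
    w (t *: a + (1 - t) *: b) = t * w a + (1 - t) * w b) -> w 0 = 0 ->
  scalar w.
Proof.
move=> wA w0.
have wZ01 t a : 0 <= t <= 1 -> w (t *: a) = t * w a.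
  by move=> /(wA t a 0); rewrite scaler0 w0 mulr0 !addr0.
have wZ0 t a : 0 <= t -> w (t *: a) = t * w a.
  move=> t0; have [t1|t1] := leP t 1; first by rewrite wZ01// t0.
  have t'0 : 0 < t by apply: lt_trans t1.
  have := wZ01 t^-1 (t *: a).
  rewrite scalerA mulVf ?gt_eqF// scale1r invr_ge0 t0 invf_le1// ltW// => /(_ isT) ->.
  by rewrite mulrA divff ?gt_eqF// mul1r.
have wD a b : w (a + b) = w a + w b.
  have -> : a + b = 2 *: (2^-1 *: a + (1 - 2^-1) *: b).
    have -> : 1 - 2^-1 = 2^-1 :> R by lra.
    by rewrite -scalerDr scalerA divff// scale1r.
  by rewrite wZ0// wA; lra.
have wN a : w (- a) = - w a by apply/eqP; rewrite -addr_eq0 -wD addNr w0.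
move=> t a b; rewrite wD; congr (_ + _).
have [/wZ0//|/ltW t0] := leP 0 t.
by rewrite -{1}[t]opprK scaleNr wN wZ0 ?oppr_ge0// mulNr opprK.
Qed.

Lemma scalar_dot n (w : 'cV[R]_n -> R) : scalar w ->
  forall x, w x = dot x (\col_i w (delta_mx i 0)).
Proof.
move=> wL x.
have w0 : w 0 = 0 by have := wL (- 1) 0 0; rewrite scaler0 addr0 mulN1r addNr.
have wD a b : w (a + b) = w a + w b by rewrite -[a]scale1r wL mul1r scale1r.
have wZ t a : w (t *: a) = t * w a by rewrite -[t *: a]addr0 wL w0 addr0.
rewrite {1}(matrix_sum_delta x) (big_morph w wD w0) dotE; apply: eq_bigr => i _.
by rewrite big_ord1 wZ mxE.
Qed.

(** B(x, y), the second difference of phi at 0, is linear in x since the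
    increment with shift y is affine, and it is symmetric, hence bilinear. Then
    B(x, x) / 2 has the same second differences as phi, so l, their difference
    minus phi(0), is additive; being measurable along each line, it is linear. *)
Lemma affine_increments_quadratic n (phi : 'cV[R]_n -> R) :
  measurable_fun setT phi ->
  (forall y t a b, 0 <= t <= 1 -> let u x := phi (x + y) - phi x in
    u (t *: a + (1 - t) *: b) = t * u a + (1 - t) * u b) ->
  exists (A : 'M[R]_n) b c, A^T = A /\
    forall x, phi x = c + (- 2^-1 * dot x (A *m x) + dot b x).
Proof.
move=> mphi phiA.
pose B x y := phi (x + y) - phi x - (phi y - phi 0).
have BC x y : B x y = B y x by rewrite /B (addrC x); ring.
have Bl y : scalar (B ^~ y).
  apply: affine_linear => [t a b t01|]; last by rewrite /B add0r; ring.
  by have := phiA y t a b t01; rewrite /B => /= ->; ring.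
pose M : 'M[R]_n := \matrix_(i, j) B (delta_mx i 0) (delta_mx j 0).
have MT : M^T = M by apply/matrixP => i j; rewrite !mxE BC.
have BE x y : B x y = dot x (M *m y).
  rewrite (scalar_dot (Bl y)); congr dot; apply/colP => i; rewrite !mxE BC.
  rewrite (scalar_dot (Bl _)) dotE; apply: eq_bigr => j _.
  by rewrite !mxE mulrC BC.
pose l x := phi x - phi 0 - 2^-1 * dot x (M *m x).
have lD : {morph l : x y / x + y}.
  move=> x y; have := BE x y; rewrite /B /l mulmxDr !dotDl !dotDr.
  rewrite (dotC y (M *m x)) dot_mulmx MT => <-.
  by field.
have lL : scalar l.
  move=> t x y; rewrite lD; congr (_ + _).
  have -> : x = 1 *: x by rewrite scale1r.
  rewrite scalerA mulr1.
  apply: (@measurable_additive_linear _ (fun s => l (s *: x))).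
    by move=> s s'; rewrite scalerDl lD.
  have mx : measurable_fun setT (fun s : R => s *: x).
    by apply: measurable_fun_mx => i j; under eq_fun do rewrite mxE; exact: measurable_funM.
  apply: measurable_funB; first apply: measurable_funB => //.
    exact: measurableT_comp mphi mx.
  apply: measurable_funM => //.
  exact: (measurableT_comp (measurable_quad M) mx).
exists (- M), (\col_i l (delta_mx i 0)), (phi 0); split.
  by rewrite linearN/= MT.
by move=> x; rewrite (dotC (\col_i _)) -(scalar_dot lL) /l mulNmx -(scaleN1r (M *m x)) dotZr; field.
Qed.

End affine_increments.

(** * Normal densities *)

Section normal_density.
Context {R : realType} {n : nat}.
Implicit Types f : 'cV[R]_n -> R.

(** ln f is a quadratic polynomial with matrix A and linear part b; as f is
    integrable, A is positive definite and the square can be completed at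
    m = A^-1 b. The multiplicative constant is then determined by the total mass
    being 1. *)
Lemma log_concave_ratio_normal f :
  measurable_fun [set: 'cV[R]_n] f -> (forall x, 0 < f x) ->
  (\int[lebesgue_measure_cV n]_x (f x)%:E = 1)%E ->
  (forall y, log_concave (fun x => f (x + y) / f x)) ->
  is_multivariate_normal_pdf f.
Proof.
move=> mf f0 f1 lcf.
have mlnf : measurable_fun setT (fun x => ln (f x)) by exact: measurableT_comp.
have [A [b [c [At lnf]]]] :=
  affine_increments_quadratic mlnf (log_concave_ratio_affine f0 lcf).
have fE x : f x = expR c * expR (- 2^-1 * dot x (A *m x) + dot b x).
  by rewrite -expRD -lnf lnK ?posrE.
move: f1; under eq_integral do rewrite fE EFinM.
rewrite ge0_integralZl_EFin ?expR_ge0//; last exact: measurable_gauss.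
move=> f1; have [|AP detA AI] := @gaussian_integral _ _ A b At.
  rewrite ltNge leye_eq; apply/eqP => Ioo; move: f1.
  by rewrite Ioo gt0_muley// lte_fin expR_gt0.
have Au : A \in unitmx by rewrite unitmxE unitfE gt_eqF.
pose m := invmx A *m b.
have Am : A *m m = b by rewrite /m mulmxA mulmxV// mul1mx.
exists m, (invmx A); split.
  move: AP => /sym_posdefE[_ AP]; apply/sym_posdefE; split.
    by rewrite trmx_inv At.
  move=> v v0; have -> : dot v (invmx A *m v) = dot (invmx A *m v) (A *m (invmx A *m v)).
    by rewrite mulmxA mulmxV// mul1mx dotC.
  apply: AP; apply: contra_neq v0 => v0.
  by rewrite -[v]mul1mx -(mulmxV Au) -mulmxA v0 mulmx0.
move=> x; rewrite /multivariate_normal_pdf invmxK -mulmxA -/(dot _ _) fE.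
have -> : - 2^-1 * dot x (A *m x) + dot b x =
    2^-1 * dot b m + - 2^-1 * dot (x - m) (A *m (x - m)).
  rewrite mulmxBr Am dotBl !dotBr (dotC m b) (dotC x b).
  by rewrite (dotC m) dot_mulmx At Am (dotC x b); field.
rewrite expRD mulrA; congr (_ * _).
move: f1; rewrite (AI m Am) -EFinM => -[] f1.
have pi2 : 0 < 2 * pi :> R by rewrite mulr_gt0// pi_gt0.
rewrite det_inv powRrM powR_mulrn ?(ltW pi2)// powR12_sqrt ?exprn_ge0 ?(ltW pi2)//.
rewrite -sqrtrM ?exprn_ge0 ?(ltW pi2)//.
have s0 : Num.sqrt ((2 * pi) ^+ n / \det A) != 0.
  by rewrite gt_eqF// sqrtr_gt0 divr_gt0// exprn_gt0.
by apply: (mulfI s0); rewrite divff// -[RHS]f1 mulrCA.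
Qed.

(** In the quotient f(x + y) / f(x) the terms of degree 2 in x cancel, leaving
    the exponential of an affine function. *)
Lemma normal_ratio_convex f : (forall x, 0 < f x) ->
  is_multivariate_normal_pdf f ->
  forall y, @convex_function R 'cV[R]_n setT (fun x => f (x + y) / f x).
Proof.
move=> f0 [m [S [_ fE]]] y.
set C := ((2 * pi) `^ (n%:R / 2) * Num.sqrt (\det S))^-1 in fE.
pose q x := dot x (invmx S *m x).
have {}fE x : f x = C * expR (- 2^-1 * q (x - m)).
  by rewrite fE /multivariate_normal_pdf -/C -mulmxA.
have C0 : C != 0 by apply/eqP => C0; have := f0 0; rewrite fE C0 mul0r ltxx.
pose e x := - 2^-1 * (q (x - m + y) - q (x - m)).
have ratioE x : f (x + y) / f x = expR (e x).
  rewrite !fE addrAC invfM mulrACA divff// mul1r -expRN -expRD; congr expR.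
  by rewrite /e; ring.
have eE x : e x = - 2^-1 *
    (dot (x - m) (invmx S *m y) + dot y (invmx S *m (x - m)) + q y).
  by rewrite /e /q mulmxDr !dotDl !dotDr; ring.
have /convex_setTP expR_convex : @convex_function R R^o setT (@expR R).
  by move=> t u v _ _; exact: convex_expR.
apply/convex_setTP => t a b t01; rewrite !ratioE.
suff -> : e (t *: a + (1 - t) *: b) = t * e a + (1 - t) * e b.
  exact: (expR_convex t (e a) (e b)).
rewrite !eE -conv_translate; move: (a - m) (b - m) => u v.
rewrite !mulmxDr -!scalemxAr !dotDl !dotDr !dotZl !dotZr; ring.
Qed.

End normal_density.

Theorem theorem1 (R : realType) (n : nat) (hn : (1 <= n)%N)
    (f : 'cV[R]_n -> R)
    (f_borel : measurable_fun [set: 'cV[R]_n] f)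
    (f_gt0 : forall x, 0 < f x)
    (f_int1 : (\int[lebesgue_measure_cV n]_x (f x)%:E = 1)%E) :
  [<-> forall y : 'cV[R]_n,
         @convex_function R 'cV[R]_n setT (fun x => f (x + y) / f x);
       forall y : 'cV[R]_n, log_convex (fun x => f (x + y) / f x);
       forall y : 'cV[R]_n, log_concave (fun x => f (x + y) / f x);
       is_multivariate_normal_pdf f].
Proof.
tfae.
- exact: convex_ratio_log_convex.
- exact: log_convex_ratio_log_concave.
- exact: log_concave_ratio_normal.
- exact: normal_ratio_convex.
Qed.
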